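(* Let $C$ be a finitely generated subgroup of infinite index in a free group $F=F(X)$ of finite rank, and let $S$ be a Schreier transversal for $C$. Then: 1) the generalized normalizer $N^*_F(C)$ of $C$ in $F$ is exponentially negligible in $F$; 2) the set of singular representatives $S_{\rm sin}$ is exponentially negligible in $F$; 3) the set $S_{\rm uns}$ of unstable representatives is exponentially negligible in $F$.
   Context: $F=F(X)$ is the free group with finite basis $X=\{x_1,\dots,x_m\}$; elements of $F$ are identified with reduced words in $X\cup X^{-1}$, and $|w|$ is the length of the reduced word $w$. Let $S_k=\{w\in F: |w|=k\}$ and, for $R\subseteq F$, $f_k(R)=|R\cap S_k|/|S_k|$. A set $R\subseteq F$ is exponentially negligible (in $F$) if there is a positive constant $\delta<1$ such that $f_k(R)<\delta^k$ for all sufficiently large $k$. A (right) transversal of $C$ is a set $S\subseteq F$ containing exactly one element from each right coset $Cu$, $u\in F$. It is Schreier if every initial segment of an element of $S$ belongs to $S$. The generalized normalizer of $C$ is $N^*_F(C)=\{f\in F : f^{-1}Cf\cap C\neq 1\}$. A representative $s\in S$ is singular if $s\in N^*_F(C)$; $S_{\rm sin}$ is the set of singular representatives in $S$. A representative $s\in S$ is stable if $sc\in S$ for every $c\in C$; $S_{\rm uns}$ is the set of elements of $S$ that are not stable. *)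

(* Defs.v *)
From HB Require Import structures.
From mathcomp Require Import all_boot all_order all_algebra finmap.
From mathcomp Require Import all_classical reals.

Set Implicit Arguments.
Unset Strict Implicit.
Unset Printing Implicit Defensive.

Import Order.TTheory GRing.Theory Num.Theory.

Local Open Scope classical_set_scope.

(* The letter (x, false) stands for x and (x, true) for x^-1. *)
Definition letter (X : finType) : finType := (X * bool)%type.

Definition linv (X : finType) (a : letter X) : letter X := (a.1, ~~ a.2).

Definition reduced (X : finType) (w : seq (letter X)) : bool :=
  sorted (fun a b => b != linv a) w.

Definition push (X : finType) (a : letter X) (w : seq (letter X)) :=
  if w is b :: w' then if b == linv a then w' else a :: w else [:: a].

Definition reduce (X : finType) (w : seq (letter X)) : seq (letter X) :=
  foldr (@push X) [::] w.

Definition winv (X : finType) (w : seq (letter X)) : seq (letter X) :=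
  rev [seq linv a | a <- w].

Section Reduction.
Context {X : finType}.
Implicit Types (a b : letter X) (u v w : seq (letter X)).

Lemma linvK : involutive (@linv X).
Proof. by case=> x e; rewrite /linv /= negbK. Qed.

Lemma push_reduced a w : reduced w -> reduced (push a w).
Proof.
case: w => [|b w] //= bw; case: (eqVneq b (linv a)) => [_|ne].
  exact: path_sorted bw.
by rewrite /reduced /= ne.
Qed.

Lemma pushK a w : reduced w -> push a (push (linv a) w) = w.
Proof.
case: w => [|b w] /=; first by rewrite eqxx.
rewrite linvK; case: (eqVneq b a) => [->|_] bw; last by rewrite /= eqxx.
by case: w bw => [|c w] //= /andP[/negbTE ->].
Qed.

Lemma reduce_reduced w : reduced (reduce w).
Proof. by elim: w => //= a w; apply: push_reduced. Qed.

Lemma reduce_id w : reduced w -> reduce w = w.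
Proof.
elim: w => //= a w IHw aw; rewrite IHw; last exact: path_sorted aw.
by case: w aw {IHw} => [|b w] //= /andP[/negbTE ->].
Qed.

Lemma reduce_catr u v : reduce (u ++ reduce v) = reduce (u ++ v).
Proof.
by rewrite /reduce !foldr_cat [foldr _ _ (foldr _ _ _)]reduce_id ?reduce_reduced.
Qed.

Lemma reduce_push_cat a u v : reduce (push a u ++ v) = push a (reduce (u ++ v)).
Proof.
case: u => [|b u] //=; case: (eqVneq b (linv a)) => [->|_] //=.
by rewrite pushK // reduce_reduced.
Qed.

Lemma reduce_catl u v : reduce (reduce u ++ v) = reduce (u ++ v).
Proof. by elim: u => //= a u IHu; rewrite reduce_push_cat IHu. Qed.

Lemma reduce_winvl w : reduce (winv w ++ w) = [::].
Proof.
elim: w => //= a w IHw.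
rewrite /winv /= rev_cons cat_rcons -[LHS]reduce_catr /=.
by rewrite -{2}[a]linvK pushK ?reduce_reduced // reduce_catr.
Qed.

Lemma winvK : involutive (@winv X).
Proof. by move=> w; rewrite /winv map_rev revK mapK //; apply: linvK. Qed.

Lemma winv_reduced w : reduced w -> reduced (winv w).
Proof.
rewrite /reduced /winv rev_sorted sorted_map; apply: sub_sorted => a b /=.
by apply: contraNN => /eqP ->; rewrite linvK.
Qed.

End Reduction.

(* The free group F(X): reduced words under concatenation and reduction. *)
Record freegroup (X : finType) := FreeGroup {
  fgword : seq (letter X);
  fgword_reduced : reduced fgword }.

Section FreeGroup.
Context {X : finType}.

HB.instance Definition _ := [isSub for @fgword X].
HB.instance Definition _ := [Choice of freegroup X by <:].

Implicit Types u v w : freegroup X.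

Definition fgone : freegroup X := @FreeGroup X [::] isT.
Definition fgmul u v : freegroup X :=
  FreeGroup (reduce_reduced (fgword u ++ fgword v)).
Definition fginv u : freegroup X := FreeGroup (winv_reduced (fgword_reduced u)).

Lemma fgmulA : associative fgmul.
Proof.
by move=> u v w; apply: val_inj; rewrite /= reduce_catr reduce_catl catA.
Qed.

Lemma fgmul1l : left_id fgone fgmul.
Proof. by case=> w rw; apply: val_inj; rewrite /= reduce_id. Qed.

Lemma fgmul1r : right_id fgone fgmul.
Proof. by case=> w rw; apply: val_inj; rewrite /= cats0 reduce_id. Qed.

Lemma fgmulVl : left_inverse fgone fginv fgmul.
Proof. by move=> u; apply: val_inj; rewrite /= reduce_winvl. Qed.

Lemma fgmulVr : right_inverse fgone fginv fgmul.
Proof.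
by move=> u; apply: val_inj; rewrite /= -{1}[fgword u]winvK reduce_winvl.
Qed.

HB.instance Definition _ := isGroup.Build (freegroup X)
  fgmulA fgmul1l fgmul1r fgmulVl fgmulVr.

End FreeGroup.

Section Groups.
Context {G : groupType}.
Local Open Scope group_scope.
Implicit Types (C A S : set G).

Definition is_subgroup C : Prop := group_closed [in C].

Definition finitely_generated C : Prop :=
  exists2 A : set G, finite_set A & C = smallest is_subgroup A.

Definition right_coset C (u : G) : set G := [set c * u | c in C].

Definition infinite_index C : Prop := infinite_set (range (right_coset C)).

Definition right_transversal C S : Prop :=
  forall u : G, exists! s : G, S s /\ right_coset C u s.

(* x ^ f is the conjugate f^-1 * x * f *)
Definition generalized_normalizer C : set G :=
  [set f | [set c ^ f | c in C] `&` C <> [set 1]].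

Definition singular_representatives C S : set G :=
  S `&` generalized_normalizer C.

Definition stable C S (s : G) : Prop := forall c, C c -> S (s * c).

Definition unstable_representatives C S : set G :=
  [set s | S s /\ ~ stable C S s].

End Groups.

Section FreeGroupSets.
Context {X : finType}.
Local Open Scope ring_scope.

Definition schreier (S : set (freegroup X)) : Prop :=
  forall s t : freegroup X, S s -> prefix (fgword t) (fgword s) -> S t.

Definition sphere (k : nat) : set (freegroup X) :=
  [set w | size (fgword w) = k].

(* fset_set is only meaningful on finite sets *)
Lemma finite_sphere (k : nat) : finite_set (sphere k).
Proof.
pose f (t : k.-tuple (letter X)) : freegroup X := FreeGroup (reduce_reduced t).
have fT : finite_set (range f) by apply: finite_image; exact: finite_finset.
apply: sub_finite_set fT.
move=> w /= /eqP wk; exists (Tuple wk) => //.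
by apply: val_inj; rewrite /= reduce_id // fgword_reduced.
Qed.

(* For k > 0 the sphere is empty when X is; the frequency is then 0 / 0 = 0. *)
Definition frequency (R : realType) (A : set (freegroup X)) (k : nat) : R :=
  #|` fset_set (A `&` sphere k)|%:R / #|` fset_set (sphere k)|%:R.

Definition exponentially_negligible (R : realType) (A : set (freegroup X)) :
    Prop :=
  exists delta : R, [/\ 0 < delta, delta < 1 &
    exists K : nat, forall k, (K <= k)%N -> frequency R A k < delta ^+ k].

End FreeGroupSets.

(* Main.v *)
Require Import Defs.
From mathcomp Require Import all_boot all_order all_algebra finmap.
From mathcomp Require Import all_classical reals.
From mathcomp Require Import zify ring lra.

Set Implicit Arguments.
Unset Strict Implicit.
Unset Printing Implicit Defensive.

Import Order.TTheory GRing.Theory Num.Theory.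
Local Open Scope nat_scope.
Local Open Scope classical_set_scope.

(** Picture the Schreier graph of [C]: its vertices are the right cosets of
[C], a letter [a] labels an edge from [C u] to [C u a], and a word is a path
starting at the vertex [C].  The reduced words that begin some element of [C]
(called openings below) are the ones read inside the core, the union of the
reduced loops at [C].  Outside the core the graph is a forest: a reduced path
that has left the core keeps moving away from it.

Geometry.  Write a reduced word as [f = p t], with [p] its longest opening, and
suppose that [t^-1] is not an opening.  Then for [c] in [C] the cancellation in
[f c] stops inside [t], so that [f c] also leaves the core right after [p]
([outward_split]).  Two reduced paths leaving the core by the same edge end at
the same vertex only if they are equal ([no_return]); if [f^-1 c f = c'] lies
in [C], then [f c'] and [f] end at the same vertex, hence [c' = 1].  Likewise,
a reduced path ending where [f c] ends must finish with the part of [f c] that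
lies outside the core, exit edge included ([suffix_of_coset]); as a Schreier
transversal contains only one path to each vertex, if it contains [f] it
contains [f c].  Hence the generalized normalizer and the unstable
representatives all have the form [u v] with [u] and [v^-1] openings.

Counting.  As [C] is finitely generated the core is finite
([finite_opening_cosets]).  As [C] has infinite index, every reduced word can
be prolonged to one that leaves a given finite set of vertices ([escape]), and
after a bounded number [D] of letters by finiteness ([uniform_escape]).  With
[2m] letters and [rho = 2m - 1] there are [rho ^ D] reduced prolongations by
[D] letters, and at least one of them is lost; so the number of openings of
length [k] is [O((theta rho) ^ k)] for some [theta < 1] ([geometric_decay]).
The products [u v] of length [k] then number [O((k + 1) (theta rho) ^ k)],
against at least [rho ^ k] words in the sphere. *)

(** * Reduced words and cancellation *)

(** Levi's lemma: two factorizations of one word have a common refinement. *)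
Lemma eq_cat_split (T : Type) (p q s t : seq T) :
  p ++ s = q ++ t -> size p <= size q -> exists2 x, q = p ++ x & s = x ++ t.
Proof.
elim: p q => [|a p IHp] [|b q] //=; first by exists [::].
  by move=> ->; exists (b :: q).
by case=> -> /IHp e; rewrite ltnS => /e[x -> ->]; exists x.
Qed.

Section Words.
Context {X : finType}.
Implicit Types (a b : letter X) (u v w r : seq (letter X)) (f : freegroup X).

Definition fgof w : freegroup X := FreeGroup (reduce_reduced w).

Lemma fgword_of w : reduced w -> fgword (fgof w) = w.
Proof. exact: reduce_id. Qed.

Lemma fgof_word f : fgof (fgword f) = f.
Proof. by apply: val_inj; rewrite /= reduce_id ?fgword_reduced. Qed.

Lemma fgof_nil : fgof [::] = 1%g.
Proof. exact: val_inj. Qed.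

Lemma fgof_cat u v : fgof (u ++ v) = (fgof u * fgof v)%g.
Proof. by apply: val_inj; rewrite /= reduce_catr reduce_catl. Qed.

Lemma fgof_inv w : fgof (winv w) = (fgof w)^-1%g.
Proof.
apply/esym/mulg1_eq; rewrite -fgof_cat -{1}[w]winvK.
by apply: val_inj; rewrite /= reduce_winvl.
Qed.

Lemma winv_cat u v : winv (u ++ v) = winv v ++ winv u.
Proof. by rewrite /winv map_cat rev_cat. Qed.

Lemma reduced_catl u v : reduced (u ++ v) -> reduced u.
Proof. by case: u => //= a u; rewrite /reduced /= cat_path => /andP[]. Qed.

Lemma reduced_catr u v : reduced (u ++ v) -> reduced v.
Proof.
case: u => //= a u; rewrite /reduced /= cat_path => /andP[_].
exact: path_sorted.
Qed.

Lemma reduced_glue u v w : v != [::] ->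
  reduced (u ++ v ++ w) = reduced (u ++ v) && reduced (v ++ w).
Proof.
case: v => // a v _; rewrite /reduced /= !sorted_cat_cons cat_path.
by case: (sorted _ _); case: (path _ _ v).
Qed.

Lemma reduced_rcons_cons u a b v :
  reduced (rcons u a ++ b :: v) =
  [&& reduced (rcons u a), b != linv a & reduced (b :: v)].
Proof.
by case: u => [|c u]; rewrite /reduced //= cat_path last_rcons.
Qed.

(** In a product of reduced words only an end of the first against the
beginning of the second can cancel, because what remains is reduced. *)
Lemma cancellation u v : reduced u -> reduced v ->
  exists u1 r v1, [/\ u = u1 ++ r, v = winv r ++ v1 & reduced (u1 ++ v1)].
Proof.
elim/last_ind: u v => [|u a IHu] [|b v] ru rv.
- by exists [::], [::], [::].
- by exists [::], [::], (b :: v).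
- by exists (rcons u a), [::], [::]; rewrite !cats0.
case: (eqVneq b (linv a)) => [eb|ne]; last first.
  exists (rcons u a), [::], (b :: v); rewrite cats0; split => //.
  by rewrite reduced_rcons_cons ru ne.
have [] := IHu v.
- by apply: (@reduced_catl _ [:: a]); rewrite cats1.
- exact: (@reduced_catr [:: b]).
move=> u1 [r [v1 [-> -> rd]]]; exists u1, (rcons r a), v1; split => //.
  by rewrite rcons_cat.
by rewrite -cats1 winv_cat /= eb.
Qed.

End Words.

(** * Cosets as vertices of the Schreier graph *)

Lemma subgroup_ops (G : groupType) (C : set G) : is_subgroup C ->
  [/\ C 1%g, forall c, C c -> C c^-1%g & forall c d, C c -> C d -> C (c * d)%g].
Proof.
move=> Csub; split=> [|c Cc|c d Cc Cd]; apply/set_mem.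
- by case: Csub.
- exact: group_closedV Csub _ (mem_set Cc).
- exact: group_closedM Csub _ _ (mem_set Cc) (mem_set Cd).
Qed.

Lemma right_coset_eqP (G : groupType) (C : set G) (u v : G) : is_subgroup C ->
  right_coset C u = right_coset C v <-> C (u * v^-1)%g.
Proof.
move=> Csub; have [C1 CV CM] := subgroup_ops Csub; split=> [euv|Cuv].
  have: right_coset C u u by exists 1%g; rewrite ?mul1g.
  by rewrite euv => -[c Cc <-]; rewrite mulgK.
apply/seteqP; split=> _ [c Cc <-].
  by exists (c * (u / v))%g; [exact: CM | rewrite -!mulgA mulVg mulg1].
exists (c / (u / v))%g; first exact/CM/CV.
by rewrite invgM invgK -!mulgA mulVg mulg1.
Qed.

Lemma mem_right_coset (G : groupType) (C : set G) (u v : G) : is_subgroup C ->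
  right_coset C u v <-> right_coset C u = right_coset C v.
Proof.
move=> Csub; split=> [[c Cc <-]|->].
  by apply/esym/right_coset_eqP => //; rewrite mulgK.
by exists 1%g; [case: Csub => /set_mem | rewrite mul1g].
Qed.

Section Cosets.
Context {X : finType} (C : set (freegroup X)).
Implicit Types (a b : letter X) (p r u v w x y z : seq (letter X)).
Implicit Types (c f : freegroup X).

Definition coset w : set (freegroup X) := right_coset C (fgof w).

(** These words label the reduced paths from the vertex [C] inside the core of
the Schreier graph. *)
Definition opening w : Prop := exists2 c, C c & prefix w (fgword c).

Context (Csub : is_subgroup C).

Lemma coset_eqP u v : coset u = coset v <-> C (fgof (u ++ winv v)).
Proof. by rewrite fgof_cat fgof_inv; apply: right_coset_eqP. Qed.

Lemma coset_catr w u v : coset u = coset v -> coset (u ++ w) = coset (v ++ w).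
Proof.
rewrite !coset_eqP !(fgof_cat, winv_cat, fgof_inv).
by rewrite invgM -!mulgA mulVKg.
Qed.

Lemma coset_catIr w u v : coset (u ++ w) = coset (v ++ w) -> coset u = coset v.
Proof.
rewrite !coset_eqP !(fgof_cat, winv_cat, fgof_inv).
by rewrite invgM -!mulgA mulVKg.
Qed.

Lemma opening_cat u v : reduced (u ++ v) -> C (fgof (u ++ v)) -> opening u.
Proof.
by move=> ruv Cuv; exists (fgof (u ++ v)); rewrite // fgword_of ?prefix_prefix.
Qed.

Lemma opening_nil : opening [::].
Proof. by exists 1%g; [case: Csub => /set_mem | exact: prefix0s]. Qed.

(** * Paths that leave the core *)

(** A reduced path [r] to a vertex reached outside the core must come in
through the same exit edge [a]: otherwise the reduced form of
[p a y r^-1], an element of [C], would still begin with [p a]. *)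
Lemma suffix_of_coset p a y r : ~ opening (rcons p a) ->
    reduced (rcons p a ++ y) -> reduced r ->
    coset (rcons p a ++ y) = coset r ->
  exists x, r = x ++ a :: y.
Proof.
move=> nop rpy rr /coset_eqP.
have [u1 [s [v1 [eu ev rd]]]] := cancellation rpy (winv_reduced rr).
rewrite eu ev fgof_cat !(fgof_cat, fgof_inv) -!mulgA mulVKg -fgof_cat => Cuv.
case: (leqP (size (rcons p a)) (size u1)) => [le_pu|].
  case: (eq_cat_split eu le_pu) => u2 eu1 _; rewrite eu1 -catA in rd Cuv.
  by case: nop; apply: opening_cat rd Cuv.
rewrite size_rcons ltnS cat_rcons in eu * => le_up.
have [x _ es] := eq_cat_split (esym eu) le_up.
by exists (winv v1 ++ x); rewrite -[r]winvK ev winv_cat winvK es catA.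
Qed.

(** If the longer path [p a y] ended at the same vertex as [p a z], then
[suffix_of_coset] would give [y = y' a z], and [g = y' a] would be a nontrivial
loop at the end of [p a].  All the powers of [g] may be appended to [p a]
without cancellation, so [suffix_of_coset] makes [a g^n] a suffix of [p a] for
every [n], which is absurd for [n] large. *)
Lemma no_return p a y z : ~ opening (rcons p a) ->
    reduced (rcons p a ++ y) -> reduced (rcons p a ++ z) ->
    coset (rcons p a ++ y) = coset (rcons p a ++ z) ->
  y = z.
Proof.
move=> nop; wlog lezy : y z / size z <= size y.
  by case: (leqP (size z) (size y)) => [|/ltnW] h wl ry rz e;
     [|apply/esym]; apply: wl.
move=> ry rz e; have [x' e'] := suffix_of_coset nop rz ry (esym e).
have sz := congr1 size e'; rewrite !size_cat [size (a :: z)]/= in sz.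
have le_px : size p <= size x'.
  by rewrite -(leq_add2r (size z).+1) -sz size_rcons addSnnS leq_add2l.
rewrite cat_rcons in e'; have [y' _] := eq_cat_split e' le_px.
case: y' => [[] //|b y' [_ ey]].
(* [g n] is the [n]-th power of the loop. *)
pose g n := flatten (nseq n (rcons y' a)).
have cg n : reduced (rcons p a ++ g n) /\
    coset (rcons p a ++ g n) = coset (rcons p a).
  elim: n => [|n [IHr IHc]].
    rewrite /g /= cats0; split=> //; exact: reduced_catl ry.
  have ryg : reduced (rcons p a ++ rcons y' a).
    by move: ry; rewrite ey -cat_rcons catA => /reduced_catl.
  have eg : g n.+1 = rcons y' a ++ g n by [].
  rewrite eg; split.
    rewrite reduced_glue; last by case: (y').
    rewrite ryg /= -cats1 -catA; move: IHr.
    rewrite -[rcons p a]cats1 -catA => /reduced_catr IHr.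
    rewrite reduced_glue // IHr andbT.
    by move: ryg; rewrite -cats1 -!catA => /reduced_catr /reduced_catr;
      rewrite cats1.
  rewrite catA -[RHS]IHc; apply: coset_catr; apply: (@coset_catIr z).
  by rewrite -catA (cat_rcons a y') -ey.
have [rg cgn] := cg (size p).+1.
have [|x /(congr1 size)] := suffix_of_coset nop rg _ cgn.
  exact: reduced_catl rg.
have : size p < size (g (size p).+1).
  rewrite size_flatten /shape map_nseq sumn_nseq size_rcons; lia.
by rewrite size_cat /= size_rcons; lia.
Qed.

(** The set that contains both the generalized normalizer and the unstable
representatives. *)
Definition opening_closing w : Prop :=
  exists u v, [/\ w = u ++ v, opening u & opening (winv v)].

Lemma last_opening w : opening w \/
  exists p a t, [/\ w = p ++ a :: t, opening p & ~ opening (rcons p a)].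
Proof.
elim/last_ind: w => [|w b [ow|[p [a [t [-> op nop]]]]]].
- by left; apply: opening_nil.
- have [owb|nowb] := pselect (opening (rcons w b)); first by left.
  by right; exists w, b, [::]; rewrite cats1.
- by right; exists p, a, (rcons t b); rewrite rcons_cat.
Qed.

(** With [p] the longest opening that begins [f], the cancellation in [f c]
cannot reach the exit letter [a], since otherwise the inverse of the remainder
[a t] of [f] would begin [c]. *)
Lemma outward_split f : ~ opening_closing (fgword f) ->
  exists p a t, [/\ fgword f = rcons p a ++ t, ~ opening (rcons p a) &
    forall c, C c -> exists2 y, reduced (rcons p a ++ y) &
      (f * c)%g = fgof (rcons p a ++ y)].
Proof.
move=> nf; have [ow|[p [a [t [ef op nop]]]]] := last_opening (fgword f).
  case: nf; exists (fgword f), [::]; rewrite cats0; split=> //.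
  exact: opening_nil.
exists p, a, t; rewrite cat_rcons; split=> // c Cc.
have nct : ~ prefix (winv (a :: t)) (fgword c).
  by move=> pc; apply: nf; exists p, (a :: t); split=> //; exists c.
have [u1 [r [v1 [eu ev rd]]]] :=
  cancellation (fgword_reduced f) (fgword_reduced c).
have eu' := etrans (esym ef) eu.
case: (leqP (size u1) (size p)) => [le_up|].
  have [x _ er] := eq_cat_split (esym eu') le_up.
  by case: nct; rewrite ev er winv_cat -catA prefix_prefix.
rewrite -(size_rcons p a) -cat_rcons in eu' * => le_pu.
have [t1 e1 _] := eq_cat_split eu' le_pu.
exists (t1 ++ v1); first by rewrite catA -e1.
rewrite catA -e1 -[f]fgof_word -[c]fgof_word eu ev !fgof_cat fgof_inv.
by rewrite -!mulgA mulVKg.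
Qed.

(** If [d = f^-1 c f] with [c] and [d] in [C], then [f d = c f] lies in the
coset of [f], and [no_return] forces [f d = f]. *)
Lemma generalized_normalizer_opening_closing :
  generalized_normalizer C `<=` [set f | opening_closing (fgword f)].
Proof.
move=> f /= nf; apply: contrapT => /outward_split[p [a [t [ef nop fC]]]].
apply: nf; apply/seteqP; split=> [_ [[c Cc <-] Cd]|_ ->]; last first.
  have [/set_mem C1 _] := Csub.
  by split=> //; exists 1%g; rewrite ?conj1g.
have [y ry ey] := fC _ Cd.
have yt : y = t.
  apply: no_return nop ry _ _; first by rewrite -ef fgword_reduced.
  have ec : coset (rcons p a ++ t) = right_coset C f.
    by rewrite /coset -ef fgof_word.
  rewrite ec /coset -ey; apply/right_coset_eqP => //.
  by rewrite conjgE mulgA mulgV mul1g mulgK.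
rewrite yt -ef fgof_word -[RHS]mulg1 in ey.
exact: mulgI ey.
Qed.

(** The representative [r] of [f c] enters the forest outside the core by the
same letter [a] as [f c].  The segments of [f] and [r] that end with this letter
are both representatives and have the same coset; hence they are equal, and so
are [r] and [f c]. *)
Lemma unstable_opening_closing S : right_transversal C S -> schreier S ->
  unstable_representatives C S `<=` [set f | opening_closing (fgword f)].
Proof.
move=> Str Ssch f /= [Sf nst]; apply: contrapT => /outward_split.
move=> [p [a [t [ef nop fC]]]]; apply: nst => c Cc.
have [y ry ey] := fC _ Cc.
have Spa : S (fgof (rcons p a)).
  apply: (Ssch f) => //; rewrite ef fgword_of ?prefix_prefix //.
  exact: reduced_catl ry.
have [r [[Sr /(mem_right_coset _ _ Csub) er] _]] := Str (f * c)%g.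
have er' : coset (rcons p a ++ y) = coset (fgword r).
  by rewrite /coset -ey er fgof_word.
have [x ex] := suffix_of_coset nop ry (fgword_reduced r) er'.
have rr := fgword_reduced r; rewrite ex -cat_rcons in rr.
have Sxa : S (fgof (rcons x a)).
  apply: (Ssch r) => //; rewrite ex -cat_rcons fgword_of ?prefix_prefix //.
  exact: reduced_catl rr.
have exp : coset (rcons x a) = coset (rcons p a).
  by apply: (@coset_catIr y); rewrite cat_rcons -ex.
have [s [_ us]] := Str (fgof (rcons p a)).
have exa : fgof (rcons x a) = fgof (rcons p a).
  rewrite -(us (fgof (rcons x a))); last by split=> //; apply/mem_right_coset.
  by rewrite -(us (fgof (rcons p a))) //; split=> //; apply/mem_right_coset.
by rewrite ey fgof_cat -exa -fgof_cat cat_rcons -ex fgof_word.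
Qed.

(** * Finiteness of the core and escape from it *)

(** Let [V] collect the cosets of the prefixes of the generators.  The elements
of [C] all of whose prefixes have their coset in [V] form a subgroup: a prefix
of [c d] is a prefix of [c], or has the coset of a prefix of [d]; a prefix of
[c^-1] has the coset of a prefix of [c]. *)
Lemma finite_opening_cosets : finitely_generated C ->
  exists2 V, finite_set V & forall w, opening w -> V (coset w).
Proof.
move=> [A finA eC].
pose P f := [set take i (fgword f) | i in `I_(size (fgword f)).+1].
pose V := (coset @` \bigcup_(f in A) P f) `|` [set coset [::]].
have PV f u : A f -> prefix u (fgword f) -> V (coset u).
  move=> Af pu; left; exists u => //; exists f => //.
  exists (size u).
    by case/prefixP: pu => v ->; rewrite /= size_cat ltnS leq_addr.
  by apply/eqP; rewrite -prefixE.
exists V.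
  rewrite finite_setU; split; last exact: finite_set1.
  apply: finite_image; apply: bigcup_finite => // f _.
  exact/finite_image/finite_II.
pose K := [set c | C c /\ forall u, prefix u (fgword c) -> V (coset u)].
have [C1 CV CM] := subgroup_ops Csub.
have KV c : K c -> K c^-1%g.
  move=> [Cc cV]; have CcV := CV _ Cc.
  split=> // u /prefixP[v ev].
  have -> : coset u = coset (winv v).
    by apply/coset_eqP; rewrite winvK -ev fgof_word.
  apply: cV; apply/prefixP; exists (winv u).
  by rewrite -winv_cat -ev /= winvK.
have KM c d : K c -> K d -> K (c * d)%g.
  move=> [Cc cV] [Cd dV]; split; first exact: CM.
  have [u1 [r [v1 [eu ev rd]]]] :=
    cancellation (fgword_reduced c) (fgword_reduced d).
  have -> : fgword (c * d)%g = u1 ++ v1.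
    rewrite -[RHS]fgword_of //; congr fgword.
    rewrite -[c]fgof_word -[d]fgof_word eu ev !fgof_cat fgof_inv.
    by rewrite -!mulgA mulVKg.
  move=> u /prefixP[v euv]; case: (leqP (size u) (size u1)) => [le|/ltnW le].
    have [x eu1 _] := eq_cat_split (esym euv) le.
    by apply: cV; rewrite eu eu1 -catA prefix_prefix.
  have [x ex ev1] := eq_cat_split euv le; rewrite ex.
  have -> : coset (u1 ++ x) = coset (winv r ++ x).
    by apply: coset_catr; apply/coset_eqP; rewrite winvK -eu fgof_word.
  by apply: dV; rewrite ev ev1 catA prefix_prefix.
have CK : C `<=` K.
  rewrite [X in X `<=` _]eC; apply: smallest_sub; last first.
    move=> f Af; split=> [|u]; last exact: PV.
    by rewrite eC; apply: sub_gen_smallest.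
  split.
    by apply/mem_set; split=> // u; rewrite prefixs0 => /eqP->; right.
  by move=> c d /set_mem Kc /set_mem Kd; apply/mem_set/KM/KV.
by move=> w [c Cc pw]; have [_] := CK c Cc; apply.
Qed.

Lemma coset_cancel u a w : coset (u ++ a :: linv a :: w) = coset (u ++ w).
Proof.
rewrite -cat1s -[linv a :: w]cat1s /coset !fgof_cat.
by rewrite [fgof [:: linv a]](fgof_inv [:: a]) mulVKg.
Qed.

Lemma reduced_pad p b n :
  reduced (rcons p b) -> reduced (rcons p b ++ nseq n b).
Proof.
move=> rp; elim: n => [|n IHn]; first by rewrite cats0.
rewrite reduced_rcons_cons rp /=; apply/andP; split.
  by rewrite /linv -pair_eqE /= /pair_eq /= eqxx; case: (b.2).
by move: IHn; rewrite cat_rcons => /reduced_catr.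
Qed.

(** Otherwise the set of vertices at the ends of the reduced prolongations of
[p b] would be finite.  It would also be closed under every letter: the only
doubtful step, [b^-1] at the end of [p b] itself, is settled because the
vertices of [p b b^n] eventually repeat, so that some positive power of [b]
fixes the vertex of [p b].  As every vertex can be reached in this way, the
index of [C] would be finite. *)
Lemma escape V p b : finite_set V -> infinite_index C -> reduced (rcons p b) ->
  exists q, reduced (rcons p b ++ q) /\ ~ V (coset (rcons p b ++ q)).
Proof.
move=> finV infC rp; apply: contrapT => nex.
have inV q : reduced (rcons p b ++ q) -> V (coset (rcons p b ++ q)).
  by move=> rq; apply: contrapT => nV; apply: nex; exists q.
pose W w := exists2 q, reduced (rcons p b ++ q) &
  coset (rcons p b ++ w) = coset (rcons p b ++ q).
(* This is the doubtful step: one letter less in the loop of powers of [b]. *)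
have back : W [:: linv b].
  pose h n := coset (rcons p b ++ nseq n b).
  have [i [j [lt_ij e_ij]]] : exists i j, i < j /\ h i = h j.
    apply: contrapT => nij; apply: infinite_nat.
    have inj_h : {in setT &, injective h}.
      move=> i j _ _ eh; apply: contrapT => /eqP; rewrite neq_ltn.
      by case/orP=> lt; apply: nij; [exists i, j | exists j, i].
    rewrite -(eq_finite_set (inj_card_eq inj_h)).
    apply: sub_finite_set finV => _ [n _ <-].
    exact/inV/reduced_pad.
  exists (nseq (j - i).-1 b); first exact: reduced_pad.
  have ec : coset (rcons p b) = coset (rcons p b ++ nseq (j - i) b).
    apply: (@coset_catIr (nseq i b)); rewrite -catA -nseqD subnK //.
    exact: ltnW.
  rewrite (coset_catr _ ec) -subn1 -[in LHS](subnK (_ : 0 < j - i)) ?subn_gt0 //.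
  by rewrite nseqD -!catA /= catA coset_cancel cats0.
(* When the last letters cancel, the vertex is that of the shorter word. *)
have all_W w : W w.
  elim/last_ind: w => [|w a [q rq eq]]; first by exists [::]; rewrite cats0.
  have eqa : coset (rcons p b ++ rcons w a) = coset (rcons p b ++ rcons q a).
    by rewrite -[rcons w a]cats1 -[rcons q a]cats1 !catA; apply: coset_catr.
  have [rqa|] := boolP (reduced (rcons p b ++ rcons q a)).
    by exists (rcons q a).
  elim/last_ind: q rq eq eqa => [|q c _] rq eq eqa.
    rewrite reduced_rcons_cons rp /= andbT negbK => /eqP ea.
    have [q' rq' eq'] := back; exists q' => //.
    by rewrite -eq' eqa ea.
  have eq_c : rcons p b ++ rcons q c = rcons (rcons p b ++ q) c.
    by rewrite rcons_cat.
  rewrite eq_c in rq.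
  have eq_ca :
      rcons p b ++ rcons (rcons q c) a = rcons (rcons p b ++ q) c ++ [:: a].
    by rewrite -eq_c cats1 rcons_cat.
  rewrite eq_ca reduced_rcons_cons rq /= andbT negbK => /eqP ea.
  exists q; first by move: rq; rewrite -cats1 => /reduced_catl.
  by rewrite eqa eq_ca ea -cats1 -catA /= coset_cancel cats0.
apply: infC; apply: sub_finite_set finV => _ [f _ <-].
have [q rq eq] := all_W (winv (rcons p b) ++ fgword f).
have -> : right_coset C f = coset (rcons p b ++ q).
  by rewrite -eq /coset !fgof_cat fgof_inv mulVKg fgof_word.
exact: inV.
Qed.

Definition inside V w : bool :=
  reduced w && `[< forall u, prefix u w -> V (coset u) >].

Lemma inside_catl V u v : inside V (u ++ v) -> inside V u.
Proof.
move=> /andP[/reduced_catl ru /asboolP inV]; rewrite /inside ru.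
by apply/asboolP => w pw; apply/inV/(prefix_trans pw)/prefix_prefix.
Qed.

(** Whether a prolongation stays reduced and where it ends depend only on the
last letter and on the coset, which leaves finitely many cases when the coset
is in [V]; otherwise the word has already escaped.  Shorter escapes are padded
with their last letter to a common length. *)
Lemma uniform_escape V : finite_set V -> infinite_index C ->
  exists2 D, 0 < D & forall p, p != [::] -> reduced p ->
    exists q, [/\ size q = D, reduced (p ++ q) & ~~ inside V (p ++ q)].
Proof.
move=> finV infC.
(* The state of a nonempty word: its coset and its last letter. *)
have exd (s : set (freegroup X) * letter X) : exists d, forall p,
    coset (rcons p s.2) = s.1 -> reduced (rcons p s.2) ->
  exists q, [/\ size q = d, reduced (rcons p s.2 ++ q) &
    ~ V (coset (rcons p s.2 ++ q))].
  case: s => x b /=.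
  have [[p [ex rp]]|nex] :=
    pselect (exists p, coset (rcons p b) = x /\ reduced (rcons p b)); last first.
    by exists 0 => p ex rp; case: nex; exists p.
  have [q [rq nV]] := escape finV infC rp; exists (size q) => p' ex' rp'.
  have rq' : reduced (rcons p' b ++ q).
    case: q rq {nV} => [|c q]; first by rewrite !cats0.
    by rewrite !reduced_rcons_cons rp' => /and3P[_ -> ->].
  exists q; split=> //.
  by rewrite (coset_catr _ (etrans ex' (esym ex))).
have [d dP] := choice exd.
pose D b := \max_(s <- fset_set V) d (s, b).
exists (\max_b D b).+1 => // p p_neq0.
case/lastP: p p_neq0 => // p b _ rp.
have [q [le_qD rq nq]] : exists q, [/\ size q <= (\max_b D b).+1,
    reduced (rcons p b ++ q) & ~~ inside V (rcons p b ++ q)].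
  have [Vp|nVp] := pselect (V (coset (rcons p b))); last first.
    exists [::]; rewrite cats0; split=> //; apply/negP => /andP[_ /asboolP h].
    by apply/nVp/h/prefix_refl.
  have [q [sq rq nV]] := dP (coset (rcons p b), b) p erefl rp.
  exists q; split=> //; last first.
    by apply/negP => /andP[_ /asboolP h]; apply/nV/h/prefix_refl.
  rewrite sq; apply: leqW; apply: leq_trans (leq_bigmax b).
  have Vpb : coset (rcons p b) \in (fset_set V : seq _).
    by rewrite in_fset_set //; apply/mem_set.
  exact: (@leq_bigmax_seq _ _ xpredT (fun s => d (s, b)) _ Vpb).
have [p' [l epq]] : exists p' l, rcons p b ++ q = rcons p' l.
  case/lastP: q {rq nq le_qD} => [|q l]; first by exists p, b; rewrite cats0.
  by exists (rcons p b ++ q), l; rewrite rcons_cat.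
exists (q ++ nseq ((\max_b D b).+1 - size q) l); rewrite catA; split.
- by rewrite size_cat size_nseq subnKC.
- by rewrite epq; apply: reduced_pad; rewrite -epq.
- by apply: contra nq; apply: inside_catl.
Qed.

End Cosets.

(** * Counting words *)

Section Counting.
Context {L : finType}.
Implicit Types (Q A B : pred (seq L)) (n i j k : nat).

Definition nwords Q n : nat := \sum_(t : n.-tuple L) Q t.

Lemma leq_nwords Q A n : (forall w, Q w -> A w) -> nwords Q n <= nwords A n.
Proof. by move=> QA; apply: leq_sum => t _; case: (boolP (Q t)) => // /QA ->. Qed.

Lemma ltn_nwords Q A n w : (forall u, Q u -> A u) ->
  size w = n -> A w -> ~~ Q w -> nwords Q n < nwords A n.
Proof.
move=> QA /eqP sw Aw nQw; rewrite /nwords.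
rewrite (bigD1 (Tuple sw)) //= [ltnRHS](bigD1 (Tuple sw)) //= Aw (negbTE nQw).
by rewrite add0n ltnS; apply: leq_sum => t _; case: (boolP (Q t)) => // /QA ->.
Qed.

Lemma nwords_cat Q j k :
  nwords Q (j + k) = \sum_(t : j.-tuple L) nwords (fun w => Q (t ++ w)) k.
Proof.
rewrite /nwords pair_big /=.
rewrite (reindex (fun s : j.-tuple L * k.-tuple L => cat_tuple s.1 s.2)) //=.
pose g (t : (j + k).-tuple L) : j.-tuple L * k.-tuple L :=
  ([tuple tnth t (lshift k i) | i < j], [tuple tnth t (rshift j i) | i < k]).
exists g => [[s1 s2] _|t _] /=.
  congr pair; apply: eq_from_tnth => i; rewrite tnth_mktuple.
    by rewrite tnth_lshift.
  by rewrite tnth_rshift.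
apply: eq_from_tnth => i; case: (split_ordP i) => i' ->.
  by rewrite tnth_lshift tnth_mktuple.
by rewrite tnth_rshift tnth_mktuple.
Qed.

Lemma nwords_split A B j k :
  nwords (fun w => A (take j w) && B (drop j w)) (j + k) =
  nwords A j * nwords B k.
Proof.
rewrite nwords_cat /nwords big_distrlr /=; apply: eq_bigr => t _.
apply: eq_bigr => s _.
by rewrite take_size_cat ?drop_size_cat ?size_tuple // mulnb.
Qed.

Lemma nwords1 Q : nwords Q 1 = \sum_(a : L) Q [:: a].
Proof.
rewrite /nwords (reindex (fun a : L => [tuple a])) //=.
exists (@thead 0 L) => [a _|t _]; first by rewrite theadE.
by apply: val_inj; case: t => -[|a []].
Qed.

End Counting.

Section WordCounting.
Context {X : finType}.
Implicit Types (Q : pred (seq (letter X))) (n i j k D : nat).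
Implicit Types (a b : letter X) (p q u v w : seq (letter X)).

Let rho := #|letter X|.-1.

Lemma nwords_winv Q n : nwords (fun w => Q (winv w)) n = nwords Q n.
Proof.
pose h (t : n.-tuple (letter X)) := rev_tuple (map_tuple (@linv X) t).
rewrite /nwords [RHS](reindex_inj (h := h)) //.
by apply: (@inv_inj _ h) => t; apply: val_inj; apply: winvK.
Qed.

(** Each new letter may be anything except the inverse of the previous one. *)
Lemma nwords_reduced_ext p k : p != [::] -> reduced p ->
  nwords (fun w => reduced (p ++ w)) k = rho ^ k.
Proof.
move=> p0 rp; elim: k => [|k IHk].
  rewrite /nwords (eq_bigr (fun=> 1)) => [|t _]; last by rewrite tuple0 cats0 rp.
  by rewrite sum_nat_const card_tuple.
rewrite -addn1 nwords_cat expnD expn1 -IHk [X in _ = X * _]/nwords big_distrl.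
apply: eq_bigr => t _; rewrite nwords1.
case: (boolP (reduced (p ++ t))) => [rpt|nrpt]; last first.
  rewrite big1 // => a _; apply/eqP; rewrite eqb0; apply: contra nrpt.
  by rewrite catA; apply: reduced_catl.
have [p' [b epb]] : exists p' b, p ++ t = rcons p' b.
  have: p ++ t != [::] by case: (p) p0.
  by case/lastP: (p ++ t) => // p' b _; exists p', b.
rewrite [RHS]mul1n /rho -[RHS](@cardC1 _ (linv b)) -sum1_card [RHS]big_mkcond /=.
apply: eq_bigr => a _; rewrite catA epb reduced_rcons_cons -epb rpt /= andbT.
by rewrite inE; case: eqVneq.
Qed.

Lemma nwords_reduced_ge n : 0 < #|letter X| -> rho ^ n <= nwords (@reduced X) n.
Proof.
case/card_gt0P=> a _; rewrite -(@nwords_reduced_ext [:: a]) //.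
by apply: leq_nwords => w; apply: (@reduced_catr _ [:: a]).
Qed.

(** At least one of the [rho ^ D] reduced prolongations of each word of length
[k] violates [Q]; the length must be positive because the first letter of a
reduced word can be chosen in [rho + 1] ways. *)
Lemma nwords_decay Q D k : (forall w, Q w -> reduced w) ->
    (forall u v, Q (u ++ v) -> Q u) ->
    (forall p, p != [::] -> reduced p -> exists q,
      [/\ size q = D, reduced (p ++ q) & ~~ Q (p ++ q)]) ->
  0 < k -> nwords Q (k + D) <= nwords Q k * (rho ^ D).-1.
Proof.
move=> Qred Qcat esc k0; rewrite nwords_cat [X in _ <= X * _]/nwords big_distrl.
apply: leq_sum => t _; case: (boolP (Q t)) => [Qt|nQt]; last first.
  rewrite /nwords big1 // => s _; apply/eqP; rewrite eqb0.
  by apply: contra nQt; apply: Qcat.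
have t0 : tval t != [::] by rewrite -size_eq0 size_tuple -lt0n.
have [q [sq rq nq]] := esc _ t0 (Qred _ Qt).
have lt_nwords : nwords (fun w => Q (t ++ w)) D < rho ^ D.
  rewrite -(@nwords_reduced_ext t) ?Qred //.
  apply: (ltn_nwords (A := fun w => reduced (t ++ w)) _ sq rq nq) => u.
  exact: Qred.
by rewrite [leqRHS]mul1n -ltnS (ltn_predK lt_nwords).
Qed.

(** A union bound over the place [i] where the word is cut. *)
Lemma nwords_two_sided Q n :
  nwords (fun w =>
    [exists i : 'I_(size w).+1, Q (take i w) && Q (winv (drop i w))]) n
    <= \sum_(i < n.+1) nwords Q i * nwords Q (n - i).
Proof.
rewrite (eq_bigr (fun i : 'I_n.+1 =>
    \sum_(t : n.-tuple (letter X)) (Q (take i t) && Q (winv (drop i t))))).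
  rewrite exchange_big /=; apply: leq_sum => t _.
  case: existsP => // -[i Qi]; have lt_i : i < n.+1.
    by rewrite -[X in _ < X.+1](size_tuple t).
  by rewrite (bigD1 (Ordinal lt_i)) //= Qi.
move=> i _; rewrite -(nwords_winv Q (n - i)) -nwords_split subnKC //.
by rewrite -ltnS.
Qed.

Lemma card_sphere (A : set (freegroup X)) k :
  #|` fset_set (A `&` sphere k)| =
  nwords (fun w => reduced w && `[< A (fgof w) >]) k.
Proof.
pose T := [seq fgof (tval t) |
                        t : k.-tuple (letter X) <- enum {: k.-tuple (letter X)} &
                        reduced t && `[< A (fgof t) >]].
have finB : finite_set (A `&` sphere k).
  by apply: sub_finite_set (finite_sphere k) => f [].
transitivity (size T).
  apply: perm_size; apply: uniq_perm; first exact: fset_uniq.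
    rewrite map_inj_in_uniq ?filter_uniq -?enumT ?enum_uniq // => s t.
    rewrite !mem_filter => /andP[/andP[rs _] _] /andP[/andP[rt _] _] e.
    by apply: val_inj; rewrite /= -(fgword_of rs) -(fgword_of rt) e.
  move=> f; rewrite in_fset_set //; apply/idP/mapP => [/set_mem[Af /eqP fk]|].
    exists (Tuple fk); last by rewrite /= fgof_word.
    rewrite mem_filter mem_enum andbT /= fgword_reduced.
    by apply/asboolP; rewrite fgof_word.
  case=> t; rewrite mem_filter => /andP[/andP[rt /asboolP At] _] ->.
  by apply/mem_set; split=> //; rewrite /sphere /= reduce_id // size_tuple.
rewrite size_map size_filter /nwords -sum1_count big_mkcond /= big_enum /=.
by apply: eq_bigr => t _; case: (_ && _).
Qed.

End WordCounting.

(** * Estimates *)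

Section Estimates.
Context {R : realType}.
Local Open Scope ring_scope.

Lemma bernoulli_ineq (x : R) n : -1 <= x -> 1 + n%:R * x <= (1 + x) ^+ n.
Proof.
move=> x_ge; elim: n => [|n IHn]; first by rewrite mul0r addr0.
have n0 : 0 <= n%:R :> R := ler0n _ _.
rewrite exprS; apply: (@le_trans _ _ ((1 + x) * (1 + n%:R * x))).
  by rewrite -natr1; nra.
by rewrite ler_wpM2l //; lra.
Qed.

(** Every [D] steps the ratio [P k / rho ^ k] shrinks by a factor of at most
[1 - rho ^- D].  Bernoulli's inequality gives a rational [theta] with
[1 - rho ^- D <= theta ^ D], which avoids extracting a [D]-th root; [A] absorbs
the first values. *)
Lemma geometric_decay (P : nat -> nat) (rho D : nat) :
    (0 < rho)%N -> (0 < D)%N ->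
    (forall k, (0 < k)%N -> (P (k + D) <= P k * (rho ^ D).-1)%N) ->
  exists theta A : R, [/\ 0 < theta < 1, 0 <= A &
    forall k, (P k)%:R <= A * (theta * rho%:R) ^+ k].
Proof.
move=> rho0 D0 dec; pose N := (rho ^ D)%N.
have N0 : (0 < N)%N by rewrite expn_gt0 rho0.
have NR0 : 0 < N%:R :> R by rewrite ltr0n.
(* [D.+1] instead of [D] keeps [theta] positive when [D = rho = 1]. *)
pose e : R := (D.+1%:R * N%:R)^-1.
have DN1 : 1 < D.+1%:R * N%:R :> R.
  by rewrite -natrM ltr1n mulSn -addn1 addnC leq_add // muln_gt0 D0.
have e0 : 0 < e by rewrite invr_gt0 (lt_trans ltr01).
have e1 : e < 1 by rewrite invf_lt1 // (lt_trans ltr01).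
pose theta := 1 - e; have th0 : 0 < theta by rewrite subr_gt0.
have rhoR0 : 0 < rho%:R :> R by rewrite ltr0n.
have tr0 k : 0 < (theta * rho%:R) ^+ k by rewrite exprn_gt0 // mulr_gt0.
have step : N.-1%:R <= (theta * rho%:R) ^+ D.
  rewrite exprMn -natrX -/N; have := @bernoulli_ineq (- e) D.
  rewrite -/theta => /(_ _); rewrite lerN2 => /(_ (ltW e1)) bern.
  apply: le_trans (ler_wpM2r (ltW NR0) bern).
  have -> : N.-1%:R = N%:R - 1 :> R by rewrite -subn1 natrB.
  rewrite mulrDl mul1r lerD2l mulrN mulNr lerN2 /e invfM mulrA mulfVK ?gt_eqF //.
  by rewrite ler_pdivrMr ?ltr0n // mul1r ler_nat.
pose A := \sum_(k < D.+1) (P k)%:R / (theta * rho%:R) ^+ k.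
have term0 k : 0 <= (P k)%:R / (theta * rho%:R) ^+ k.
  by rewrite divr_ge0 // ltW.
have A0 : 0 <= A by apply: sumr_ge0.
exists theta, A; split=> //; first by rewrite th0 /theta; lra.
elim/ltn_ind=> k IHk; case: (leqP k D) => [le_kD|lt_Dk].
  rewrite -ler_pdivrMr // /A.
  have lt_kD : (k < D.+1)%N by [].
  by rewrite (bigD1 (Ordinal lt_kD)) //= lerDl sumr_ge0.
have kD0 : (0 < k - D)%N by rewrite subn_gt0.
have ek : k = ((k - D) + D)%N by rewrite subnK // ltnW.
rewrite {1}ek; apply: le_trans (_ : ((P (k - D)%N * N.-1)%N)%:R <= _).
  by rewrite ler_nat; apply: dec.
rewrite [in leRHS]ek exprD mulrA natrM ler_pM //.
by apply: IHk; rewrite ltn_subrL D0 (leq_ltn_trans _ lt_Dk).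
Qed.

(** With [delta = theta (1 + e) ^ 2], one factor [(1 + e) ^ k] dominates
[(k + 1) e] and the other, for large [k], dominates [B / e], both by Bernoulli's
inequality. *)
Lemma linear_geometric (B theta : R) : 0 <= B -> 0 < theta < 1 ->
  exists delta : R, [/\ 0 < delta, delta < 1 &
    exists K : nat, forall k, (K <= k)%N ->
      k.+1%:R * B * theta ^+ k < delta ^+ k].
Proof.
move=> B0 /andP[th0 th1]; pose e := (1 - theta) / 4.
have e0 : 0 < e by rewrite /e; lra.
have e1 : e < 1 by rewrite /e; lra.
exists (theta * (1 + e) ^+ 2); split.
- by rewrite mulr_gt0 // exprn_gt0 //; lra.
- by rewrite expr2 /e; nra.
pose K := Num.bound (B / e ^+ 2); exists K => k le_Kk.
have Be : B < k%:R * e ^+ 2.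
  rewrite -ltr_pdivrMr ?exprn_gt0 //.
  apply: lt_le_trans (_ : K%:R <= _); last by rewrite ler_nat.
  by apply: archi_boundP; rewrite divr_ge0 // exprn_ge0 // ltW.
have bern : 1 + k%:R * e <= (1 + e) ^+ k by apply: bernoulli_ineq; lra.
have k0 : 0 <= k%:R :> R := ler0n _ _.
rewrite exprMn -exprM mulnC exprM [ltRHS]mulrC.
rewrite ltr_pM2r ?exprn_gt0 //; set y := (1 + e) ^+ k in bern *.
have h1 : k.+1%:R * e <= y by rewrite -natr1; nra.
have h2 : B < y * e by rewrite expr2 in Be; nra.
have y0 : 0 < y by rewrite exprn_gt0 //; lra.
have -> : k.+1%:R * B = (k.+1%:R * e) * (B / e).
  by rewrite mulrACA mulfV ?gt_eqF // mulr1.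
apply: le_lt_trans (_ : y * (B / e) < _).
  by rewrite ler_wpM2r // divr_ge0 // ltW.
by rewrite expr2 ltr_pM2l // ltr_pdivrMr.
Qed.

End Estimates.

(** * Negligible sets *)

Section Negligible.
Context {R : realType} {X : finType}.
Local Open Scope ring_scope.

Lemma negligible_subset (A B : set (freegroup X)) : A `<=` B ->
  exponentially_negligible R B -> exponentially_negligible R A.
Proof.
move=> AB [delta [d0 d1 [K KP]]]; exists delta; split=> //; exists K => k le_Kk.
apply: le_lt_trans (KP k le_Kk); rewrite /frequency ler_wpM2r ?invr_ge0 //.
rewrite ler_nat !card_sphere; apply: leq_nwords => w.
by case/andP=> -> /asboolP Af; apply/asboolP/AB.
Qed.

(** The counting argument is applied to the words that stay in the finite set
[V] of cosets: they contain the openings, and membership is a condition on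
cosets, as [uniform_escape] needs. *)
Lemma opening_closing_negligible (C : set (freegroup X)) :
  is_subgroup C -> finitely_generated C -> infinite_index C ->
  exponentially_negligible R [set f | opening_closing C (fgword f)].
Proof.
move=> Csub Cfg Cinf.
have [V finV openV] := finite_opening_cosets Csub Cfg.
have [D D0 esc] := uniform_escape Csub finV Cinf.
have open_inside w : opening C w -> inside C V w.
  move=> ow; have [c Cc pw] := ow; apply/andP; split.
    case/prefixP: pw => v ev.
    by have := fgword_reduced c; rewrite ev => /reduced_catl.
  by apply/asboolP => u pu; apply: openV; exists c => //; apply: prefix_trans pw.
have [a _] : exists a : letter X, True.
  apply: contrapT => noa; apply: Cinf.
  apply: sub_finite_set (finite_set1 (right_coset C 1%g)) => _ [f _ <-].
  congr right_coset; rewrite -[f]fgof_word -fgof_nil; congr fgof.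
  by case: (fgword f) => // b w; case: noa; exists b.
pose rho := #|letter X|.-1.
have rho0 : (0 < rho)%N.
  rewrite /rho -(@cardC1 _ a); apply/card_gt0P; exists (linv a).
  by rewrite inE /= -pair_eqE /= /pair_eq /= eqxx; case: (a.2).
have L0 : (0 < #|letter X|)%N by apply/card_gt0P; exists a.
pose P := nwords (inside C V).
have dec k : (0 < k)%N -> (P (k + D) <= P k * (rho ^ D).-1)%N.
  apply: nwords_decay => //; first by move=> w /andP[].
  by move=> u v; apply: inside_catl.
have [theta [A [th01 A0 PA]]] := @geometric_decay R P _ _ rho0 D0 dec.
have [|delta [d0 d1 [K KP]]] := @linear_geometric R (A ^+ 2) theta _ th01.
  exact: exprn_ge0.
exists delta; split=> //; exists K => k le_Kk; apply: le_lt_trans (KP k le_Kk).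
have rhok0 : 0 < (rho ^ k)%:R :> R by rewrite ltr0n expn_gt0 rho0.
have nwords_le :
  (#|` fset_set ([set f | opening_closing C (fgword f)] `&` sphere k)|
    <= \sum_(i < k.+1) P i * P (k - i))%N.
  rewrite card_sphere; apply: leq_trans (nwords_two_sided _ _).
  apply: leq_nwords => w.
  case/andP=> rw /asboolP; rewrite /= reduce_id // => -[u [v [-> ou ov]]].
  have lt_u : (size u < (size (u ++ v)).+1)%N by rewrite ltnS size_cat leq_addr.
  apply/existsP; exists (Ordinal lt_u) => /=.
  by rewrite take_size_cat // drop_size_cat // !open_inside.
have sphere_ge : (rho ^ k <= #|` fset_set (@sphere X k)|)%N.
  rewrite -[sphere k]setTI card_sphere; apply: leq_trans (nwords_reduced_ge _ L0) _.
  by apply: leq_nwords => w ->; apply/asboolP.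
rewrite /frequency ler_pdivrMr; last first.
  by rewrite ltr0n (leq_trans _ sphere_ge) // expn_gt0 rho0.
apply: le_trans (_ : (k.+1%:R * A ^+ 2 * theta ^+ k) * (rho ^ k)%:R <= _); last first.
  rewrite ler_wpM2l ?ler_nat // !mulr_ge0 ?exprn_ge0 //.
  by case/andP: th01 => /ltW.
apply: (@le_trans _ _ (\sum_(i < k.+1) P i * P (k - i))%N%:R).
  by rewrite ler_nat.
rewrite natr_sum.
apply: (@le_trans _ _ (\sum_(i < k.+1) A ^+ 2 * (theta * rho%:R) ^+ k)).
  apply: ler_sum => i _; rewrite natrM.
  have -> : A ^+ 2 * (theta * rho%:R) ^+ k =
      (A * (theta * rho%:R) ^+ i) * (A * (theta * rho%:R) ^+ (k - i)).
    rewrite mulrACA -expr2 -exprD.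
    by rewrite (subnKC (leq_ord i)).
  by rewrite ler_pM.
by rewrite sumr_const card_ord exprMn natrX -!mulrA mulr_natl.
Qed.

End Negligible.

Theorem theorem4p9 (R : realType) (X : finType) (C S : set (freegroup X)) :
  is_subgroup C -> finitely_generated C -> infinite_index C ->
  right_transversal C S -> schreier S ->
  [/\ exponentially_negligible R (generalized_normalizer C),
      exponentially_negligible R (singular_representatives C S) &
      exponentially_negligible R (unstable_representatives C S)].
Proof.
move=> Csub Cfg Cinf Str Ssch.
have OC := opening_closing_negligible Csub Cfg Cinf.
have N := negligible_subset (generalized_normalizer_opening_closing Csub) (OC R).
split=> //.
- by apply: negligible_subset N => s [].
- exact: negligible_subset (unstable_opening_closing Csub Str Ssch) (OC R).
Qed.
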